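(* Let $X\subseteq\mathbb{R}^d$ be compact and convex, let $f$ be lower semi-continuous on $X\times\Delta$ and such that $f(\cdot,\delta)$ is convex on $X$ for every $\delta\in\Delta$, and suppose there exists $x\in X$ with $f(x,\delta)\le 0$ for all $\delta\in\Delta$. Suppose there is a strictly increasing function $\varphi:\mathbb{R}^+\to[0,1]$ such that $\mathbb{P}\{\mathbb{B}_r(\delta)\cap\Delta\}\ge\varphi(r)$ for all $\delta\in\mathrm{cl}(\Delta)$ and all $r\in\mathbb{R}^+$. Assume there exists a constant $L_g\ge 0$ such that for all $\omega=(\delta_1,\dots,\delta_d)$ and $\omega'=(\delta_1',\dots,\delta_d')$ in $\mathrm{cl}(\Delta)^d$, $$|g_d(\omega)-g_d(\omega')|\le L_g\max_{i\in\{1,\dots,d\}}\|\delta_i-\delta_i'\| .$$ Suppose moreover that: (Slater's condition) there exists $x_0\in X$ such that $\sup_{\delta\in\Delta}f(x_0,\delta)<0$; (Lipschitz continuity) there is a constant $L_\delta\ge 0$ such that for every $x\in X$ and all $\delta_1,\delta_2\in\mathrm{cl}(\Delta)$, $|f(x,\delta_1)-f(x,\delta_2)|\le L_\delta\|\delta_1-\delta_2\|$. Put $$L_{SP}:=\frac{\min_{x\in X}c^\top x-c^\top x_0}{\sup_{\delta\in\Delta}f(x_0,\delta)} .$$ Let $N\ge d$ be an integer and let $\omega_N$ be a vector of $N$ i.i.d. samples drawn according to $\mathbb{P}$. Then for any $\beta\in(0,1)$ for which $\varphi^{-1}(\Phi_a^{-1}(\beta;d,N))$ is defined, $$\mathbb{P}^N\{\omega_N\in\Delta^{N}: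 J^\star-g_N(\omega_N)\le L_{SP}L_\delta\,\varphi^{-1}(\Phi_a^{-1}(\beta;d,N))\}\ge 1-\beta .$$
   Context: Setting: $d\ge 1$ is an integer, $c\in\mathbb{R}^d$, $X\subseteq\mathbb{R}^d$, $\Delta\subseteq\mathbb{R}^m$ is nonempty, and $\mathrm{cl}(\Delta)$ is its closure in $\mathbb{R}^m$. The function $f$ is real-valued and defined on $X\times\mathrm{cl}(\Delta)$. $(\Delta,\mathcal{B}(\Delta),\mathbb{P})$ is a probability space with $\mathcal{B}(\Delta)$ the Borel $\sigma$-algebra of $\Delta$ and $\mathbb{P}$ having support $\Delta$; $\mathbb{P}^N$ is the product measure on $\Delta^N$. $\mathbb{R}^+=[0,\infty)$, $\|\cdot\|$ is the Euclidean norm, and $\mathbb{B}_r(\delta)$ is the open ball centered at $\delta$ with radius $r$. Robust convex program: $J^\star:=\inf\{c^\top x: x\in X,\ f(x,\delta)\le 0\ \forall\delta\in\Delta\}$. Scenario program value: for an integer $k\geq 1$ and $\omega=(\delta_1,\dots,\delta_k)\in\mathrm{cl}(\Delta)^k$, $g_k(\omega):=\inf\{c^\top x: x\in X,\ f(x,\delta_i)\le 0,\ i=1,\dots,k\}$. $\Phi_a(\epsilon;d,N):=d(1-\epsilon)^N$ for $\epsilon\in[0,1]$, and $\Phi_a^{-1}(\cdot;d,N)$ is the inverse of $\epsilon\mapsto\Phi_a(\epsilon;d,N)$ on $[0,1]$ with $d,N$ fixed. $\varphi^{-1}$ is the inverse of the strictly increasing (hence injective) function $\varphi$, defined on the range $\varphi(\mathbb{R}^+)$.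 *)

(* Defs.v *)
From HB Require Import structures.
From mathcomp Require Import all_boot all_order all_algebra.
From mathcomp Require Import all_classical all_reals all_analysis.
Set Implicit Arguments.
Unset Strict Implicit.
Unset Printing Implicit Defensive.
Import Order.TTheory GRing.Theory Num.Theory.
Import numFieldNormedType.Exports.
Local Open Scope classical_set_scope.
Local Open Scope ring_scope.

(* The library norm on 'rV[R]_n is the sup norm: it induces the usual topology,
   but metric quantities have to go through [enorm]. *)
Definition enorm (R : realType) (n : nat) (v : 'rV[R]_n) : R :=
  Num.sqrt (\sum_(i < n) v ord0 i ^+ 2).

Definition eball (R : realType) (n : nat) (u : 'rV[R]_n) (r : R) :
    set 'rV[R]_n :=
  [set v | enorm (v - u) < r].

Definition dotp (R : realType) (n : nat) (c x : 'rV[R]_n) : R :=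
  \sum_(i < n) c ord0 i * x ord0 i.

(* [Delta] with its subspace topology, as a type of its own: [Delta] need not
   be a Borel subset of R^m. Measurable types being pointed in the library, the
   type carries the proof that [Delta] is nonempty; the chosen point plays no
   other role. *)
Definition subspaceOf (R : realType) (m : nat) (Delta : set 'rV[R]_m)
    (Delta0 : Delta !=set0) : Type := set_type Delta.

Section subspaceOf_instances.
Context (R : realType) (m : nat) (Delta : set 'rV[R]_m)
  (Delta0 : Delta !=set0).

HB.instance Definition _ :=
  Topological.copy (subspaceOf Delta0) (set_type Delta).

HB.instance Definition _ := isPointed.Build (subspaceOf Delta0)
  (exist _ (projT1 (cid Delta0)) (mem_set (projT2 (cid Delta0)))).

End subspaceOf_instances.

Definition borelSpace (R : realType) (m : nat) (Delta : set 'rV[R]_m)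
    (Delta0 : Delta !=set0) :=
  g_sigma_algebraType (@open (subspaceOf Delta0)).

Definition toRm (R : realType) (m : nat) (Delta : set 'rV[R]_m)
    (Delta0 : Delta !=set0) (t : borelSpace Delta0) : 'rV[R]_m :=
  @set_val _ Delta t.

Definition msupport (R : realType) (m : nat) (Delta : set 'rV[R]_m)
    (Delta0 : Delta !=set0) (P : probability (borelSpace Delta0) R) :
    set (subspaceOf Delta0) :=
  [set t | forall U : set (subspaceOf Delta0),
    open U -> U t -> (0 < P U)%E].

Section power_probability.
Context d (T : measurableType d) (R : realType).
Variable P : probability T R.

Definition consT (n : nat) (x : T * n.-tuple T) : n.+1.-tuple T :=
  [tuple of x.1 :: x.2].

Lemma measurable_consT (n : nat) :
  measurable_fun [set: T * n.-tuple T] (@consT n).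
Proof. exact: measurable_cons. Qed.

HB.instance Definition _ (n : nat) :=
  @isMeasurableFun.Build _ _ _ _ (@consT n) (@measurable_consT n).

(* The n-fold product of [P] on T^n, for the product sigma-algebra. *)
Fixpoint power_probability (n : nat) : probability (n.-tuple T) R :=
  if n is k.+1 then
    distribution (P \x power_probability k)%E (@consT k)
  else \d_([tuple] : 0.-tuple T).

Lemma power_probability_box (n : nat) (A : 'I_n -> set T) :
  (forall i, measurable (A i)) ->
  power_probability n [set w | forall i, A i (tnth w i)] =
  (\prod_(i < n) P (A i))%E.
Proof.
elim: n A => [|n IHn] A mA /=.
  rewrite big_ord0 (_ : [set _ | _] = setT) ?diracT//.
  by apply/seteqP; split => // w _ [].
have mbox k (B : 'I_k -> set T) : (forall i, measurable (B i)) ->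
    measurable [set w : k.-tuple T | forall i, B i (tnth w i)].
  move=> mB.
  have -> : [set w : k.-tuple T | forall i, B i (tnth w i)] =
      \bigcap_(i in [set: 'I_k]) ((fun w => tnth w i) @^-1` B i).
    by apply/seteqP; split => [w Bw i _|w Bw i]; [exact: (Bw i)|exact: (Bw i Logic.I)].
  apply: fin_bigcap_measurable => // i _.
  by rewrite -[X in measurable X]setTI; exact: measurable_tnth.
rewrite /distribution /pushforward /=.
rewrite (_ : _ @^-1` _ = A ord0 `*`
    [set w : n.-tuple T | forall i, A (lift ord0 i) (tnth w i)]); last first.
  apply/seteqP; split => [[x w] /= Axw|[x w] /= [Ax Aw] i].
    by split=> [|i]; [exact: (Axw ord0)|move: (Axw (lift ord0 i)); rewrite tnthS].
  have [j ->|->] := unliftP ord0 i; last exact: Ax.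
  by rewrite tnthS; exact: Aw.
have mAl i : measurable (A (lift ord0 i)) by exact: mA.
rewrite product_measure1E.
- by rewrite big_ord_recl; congr (_ * _)%E; exact: (IHn (A \o lift ord0)).
- exact: mA.
- exact: (mbox n (A \o lift ord0)).
Qed.

End power_probability.

Section programs.
Context (R : realType) (d m : nat).
Variables (c : 'rV[R]_d) (X : set 'rV[R]_d) (f : 'rV[R]_d -> 'rV[R]_m -> R).

(* The real [inf] is 0 on sets that are empty or unbounded below; for a compact
   [X] and a feasible program it is the genuine infimum. *)
Definition robust_value (Delta : set 'rV[R]_m) : R :=
  inf [set dotp c x |
    x in [set x | X x /\ forall delta, Delta delta -> f x delta <= 0]].

Definition scenario_value (k : nat) (omega : k.-tuple 'rV[R]_m) : R :=
  inf [set dotp c x |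
    x in [set x | X x /\ forall i, f x (tnth omega i) <= 0]].

(* The numerator contains the minimum of [dotp c] over [X], attained when [X]
   is nonempty and compact. *)
Definition slater_constant (Delta : set 'rV[R]_m) (x0 : 'rV[R]_d) : R :=
  (inf (dotp c @` X) - dotp c x0) / sup (f x0 @` Delta).

End programs.

Definition Phi_a (R : realType) (d N : nat) (eps : R) : R :=
  d%:R * (1 - eps) ^+ N.

Definition Phi_a_inv (R : realType) (d N : nat) : R -> R :=
  'pinv_(fun=> 0) `[0, 1] (@Phi_a R d N).

(* The inverse of a function on [0, +oo[; as a total function, it is meaningful
   on the image of [0, +oo[ only. *)
Definition inv_nneg (R : realType) (phi : R -> R) : R -> R :=
  'pinv_(fun=> 0) `[0, +oo[ phi.

(* Main.v *)
Require Import Defs.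
From mathcomp Require Import all_boot all_order all_algebra.
From mathcomp Require Import all_classical all_reals all_analysis.
From mathcomp Require Import ring lra.
Set Implicit Arguments.
Unset Strict Implicit.
Unset Printing Implicit Defensive.
Import Order.TTheory GRing.Theory Num.Theory.
Import numFieldNormedType.Exports.
Local Open Scope classical_set_scope.
Local Open Scope ring_scope.

(** By Helly's theorem and the compactness of [X], for every [t] below the robust
    optimal value there are [d] constraints, with parameters in [Delta], whose
    scenario value is at least [t]: the constraints together with the sublevel
    set [dotp c x <= t] have no common point, hence neither do some [d + 1] of
    these convex sets, and the sublevel set has to be one of them.  A sample
    having, for each of these [d] parameters, a point within distance [r]
    satisfies at least the [d] constraints up to an error [L_delta * r], which
    Slater's point converts into a loss of value of at most
    [slater_constant * L_delta * r].  By the union bound such samples have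
    probability at least [1 - d * (1 - phi r) ^+ N].  Letting [t] tend to the
    robust value, continuity of the measure from above removes the remaining
    gap; working with [t] instead of the robust value itself avoids the
    compactness of [closure Delta]. *)

(** * Convexity with real coefficients, and finite convex combinations *)

Section convexity.
Context (R : realType) (V : lmodType R).
Implicit Types A : set (convex_lmodType V).

Lemma convex_setP A : convex_set A <->
  (forall (x y : V) (t : R), 0 <= t <= 1 -> A x -> A y ->
    A (t *: x + (1 - t) *: y)).
Proof.
split=> [cA x y t /andP[t0 t1] Ax Ay|cA x y t /set_mem Ax /set_mem Ay].
  have := cA x y (Itv01 t0 t1) (mem_set Ax) (mem_set Ay).
  by move/set_mem.
by apply/mem_set; apply: cA => //; rewrite ge0/= le1.
Qed.

Lemma convex_functionP A (f : V -> R) :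
  convex_function A (f : convex_lmodType V -> R^o) <->
  (forall (x y : V) (t : R), 0 <= t <= 1 -> A x -> A y ->
    f (t *: x + (1 - t) *: y) <= t * f x + (1 - t) * f y).
Proof.
split=> [cf x y t /andP[t0 t1] Ax Ay|cf t x y /set_mem Ax /set_mem Ay].
  exact: (cf (Itv01 t0 t1) x y (mem_set Ax) (mem_set Ay)).
by apply: cf => //; rewrite ge0/= le1.
Qed.

(** Partial sums are joined two at a time: the normalized sum of two of them is the convex
    combination of the normalized summands with coefficient [s1 / (s1 + s2)]. *)
Lemma convex_set_sum A (I : finType) (Q : pred I) (a : I -> R) (x : I -> V) :
  convex_set A -> (forall i, Q i -> 0 <= a i) -> (forall i, Q i -> A (x i)) ->
  0 < \sum_(i | Q i) a i ->
  A ((\sum_(i | Q i) a i)^-1 *: \sum_(i | Q i) a i *: x i).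
Proof.
move=> /convex_setP cA a0 Ax.
(* The first alternative covers partial sums of total weight zero, which cannot be normalized. *)
pose K (s : R) (v : V) := (s = 0 /\ v = 0) \/ (0 < s /\ A (s^-1 *: v)).
suff : K (\sum_(i | Q i) a i) (\sum_(i | Q i) a i *: x i).
  by case=> [[-> _]|[]//]; rewrite ltxx.
apply: big_ind2 => [|s1 v1 s2 v2 K1 K2|i Qi].
- by left.
- case: K1 => [[-> ->]|[s1_gt0 Av1]]; first by rewrite !add0r.
  case: K2 => [[-> ->]|[s2_gt0 Av2]]; first by rewrite !addr0; right.
  right; split; first exact: addr_gt0.
  have s_gt0 : 0 < s1 + s2 by exact: addr_gt0.
  have -> : (s1 + s2)^-1 *: (v1 + v2) =
      (s1 / (s1 + s2)) *: (s1^-1 *: v1) +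
      (1 - s1 / (s1 + s2)) *: (s2^-1 *: v2).
    rewrite scalerDr !scalerA; congr (_ *: _ + _ *: _); field;
      by rewrite ?gt_eqF.
  apply: cA => //; apply/andP; split; first by rewrite divr_ge0// ltW.
  by rewrite ler_pdivrMr// mul1r lerDl ltW.
- have [ai0|ai_neq0] := eqVneq (a i) 0; first by left; rewrite ai0 scale0r.
  right; split; first by rewrite lt_neqAle eq_sym ai_neq0 a0.
  by rewrite scalerA mulVf// scale1r; exact: Ax.
Qed.

End convexity.

(** * Helly's theorem by way of Radon points *)

Section Helly.
Context (R : realType) (d : nat).

(** The vectors [p i] extended by a coordinate 1 are more than [d + 1] rows in dimension [d + 1],
    hence linearly dependent; the extra column yields the zero sum. *)
Lemma affine_dependence (n : nat) (p : 'I_n -> 'rV[R]_d) : (d.+1 < n)%N ->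
  exists a : 'I_n -> R,
    [/\ exists i, a i != 0, \sum_i a i = 0 & \sum_i a i *: p i = 0].
Proof.
move=> dn.
pose M : 'M[R]_(n, d + 1) := row_mx (\matrix_i p i) (const_mx 1).
have kM : kermx M != 0.
  rewrite kermx_eq0 /row_free neq_ltn.
  by rewrite (leq_ltn_trans (rank_leq_col M))// addn1.
have /rowV0Pn[u /sub_kermxP uM u0] := kM.
have := uM; rewrite mul_mx_row -(row_mx0 R 1 d 1) => /eq_row_mx[up u1].
exists (fun i => u ord0 i); split.
- have [i ui|u_eq0] := pickP (fun i => u ord0 i != 0); first by exists i.
  case/negP: u0; apply/eqP/rowP => i.
  by move/negbFE: (u_eq0 i) => /eqP ->; rewrite mxE.
- transitivity ((u *m const_mx 1 : 'M[R]_1) ord0 ord0).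
    by rewrite mxE; apply: eq_bigr => i _; rewrite mxE mulr1.
  by rewrite u1 mxE.
- transitivity (u *m \matrix_i p i); last exact: up.
  apply/rowP => j; rewrite summxE mxE.
  by apply: eq_bigr => i _; rewrite !mxE.
Qed.

(* The Radon point of the [p i] lies in the convex hulls of the points with a
   positive and with a nonpositive coefficient. *)
Lemma radon_point (n : nat) (p : 'I_n -> 'rV[R]_d) : (d.+1 < n)%N ->
  exists (Q : pred 'I_n) (q : 'rV[R]_d),
  forall A : set (convex_lmodType 'rV[R]_d), convex_set A ->
    (forall i, Q i -> A (p i)) \/ (forall i, ~~ Q i -> A (p i)) -> A q.
Proof.
move=> /affine_dependence-/(_ p)[a [[k ak] sum_a sum_ap]].
pose Q := [pred i | 0 < a i].
pose S := \sum_(i | Q i) a i.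
(* Both sides carry the same total weight, so one normalization serves for both hulls. *)
have SN : S = \sum_(i | ~~ Q i) - a i.
  by move/eqP: sum_a; rewrite (bigID Q)/= addr_eq0 -sumrN => /eqP.
have S0 : 0 < S.
  have [[i ai]|a_le0] := pselect (exists i, 0 < a i).
    rewrite /S (bigD1 i)//= ltr_wpDr// sumr_ge0// => j /andP[]/= + _.
    exact: ltW.
  have {}a_le0 i : a i <= 0 by rewrite leNgt; apply/negP => ?; apply: a_le0; exists i.
  have nQ i : ~~ Q i by rewrite /= -leNgt.
  rewrite SN (bigD1 k) ?nQ//=; apply: ltr_wpDr.
    by apply: sumr_ge0 => j _; rewrite oppr_ge0.
  by rewrite oppr_gt0 lt_neqAle ak a_le0.
exists Q, (S^-1 *: \sum_(i | Q i) a i *: p i) => A cA [Ap|Ap].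
  by apply: convex_set_sum => // i /ltW.
have -> : \sum_(i | Q i) a i *: p i = \sum_(i | ~~ Q i) (- a i) *: p i.
  under [RHS]eq_bigr do rewrite scaleNr.
  by move/eqP: sum_ap; rewrite (bigID Q)/= addr_eq0 -sumrN => /eqP.
rewrite SN; apply: convex_set_sum => //; last by rewrite -SN.
by move=> i; rewrite /= -leNgt oppr_ge0.
Qed.

(** Induction on the number of sets: [p i] lies in all of them but the [i]-th. For each [k], the
    Radon point is a convex combination of the [p i] on the side not containing [k], all of which
    lie in [F (u k)]. *)
Lemma helly (I : Type) (F : I -> set (convex_lmodType 'rV[R]_d)) :
  (forall i, convex_set (F i)) ->
  (forall u : 'I_d.+1 -> I, exists x, forall k, F (u k) x) ->
  forall n (u : 'I_n -> I), exists x, forall k, F (u k) x.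
Proof.
move=> cF Fd; elim=> [|n IHn] u; first by exists 0; case.
have [dn|nd] := ltnP d n; last first.
  (* At most [d + 1] sets: the family is padded by repetition, since [inord] sends indices out of
     range to [ord0]. *)
  have [x Fx] := Fd (fun k => u (inord k)).
  exists x => k; have := Fx (inord k); rewrite inordK ?inord_val//.
  by rewrite (leq_trans (ltn_ord k)).
have /choice[p Fp] : forall i, exists x : 'rV[R]_d, forall k, F (u (lift i k)) x.
  by move=> i; exact: IHn.
have [Q [q Qq]] := radon_point p (dn : (d.+1 < n.+1)%N).
have Fpik i k : i != k -> F (u k) (p i).
  by have [j ->|->] := unliftP i k => [_|/eqP//]; exact: Fp.
exists q => k; apply: Qq => //.
have [Qk|nQk] := boolP (Q k); [right|left] => i Qi; apply: Fpik;
  by apply: contraTneq Qi => ->; rewrite // Qk.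
Qed.

End Helly.

(** * The linear objective *)

Section dotp.
Context (R : realType) (d : nat) (c : 'rV[R]_d).

Lemma dotpD x y : dotp c (x + y) = dotp c x + dotp c y.
Proof. by rewrite -big_split; apply: eq_bigr => i _; rewrite mxE mulrDr. Qed.

Lemma dotpZ a x : dotp c (a *: x) = a * dotp c x.
Proof. by rewrite mulr_sumr; apply: eq_bigr => i _; rewrite mxE mulrCA. Qed.

Lemma dotp_continuous : continuous (dotp c).
Proof.
apply: continuous_big => [|i _ x]; first exact: add_continuous.
apply: (@continuous_comp _ _ _ (fun x : 'rV[R]_d => x ord0 i)).
  exact: coord_continuous.
exact: mulrl_continuous.
Qed.

Lemma dotp_has_lbound (X : set 'rV[R]_d) :
  compact X -> has_lbound (dotp c @` X).
Proof.
move=> cX; have : compact (dotp c @` X).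
  apply: continuous_compact => //.
  exact/continuous_subspaceT/dotp_continuous.
move=> /compact_bounded[M [_ /(_ (M + 1))]].
rewrite ltrDl ltr01 => /(_ isT) Mb; exists (- (M + 1)) => y /Mb /=.
by rewrite ler_norml => /andP[].
Qed.

End dotp.

(** * Programs over a compact set and reduction to [d] constraints *)

Section constraints.
Context (R : realType) (d m : nat) (c : 'rV[R]_d) (X : set 'rV[R]_d)
  (f : 'rV[R]_d -> 'rV[R]_m -> R).
Context (X_compact : compact X).

Lemma dotp_has_lboundS (Y : set 'rV[R]_d) :
  Y `<=` X -> has_lbound (dotp c @` Y).
Proof.
have [M Mb] := dotp_has_lbound c X_compact => YX.
by exists M => _ [x /YX Xx <-]; apply: Mb; exists x.
Qed.

Lemma scenario_value_le k (w : k.-tuple 'rV[R]_m) x :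
  X x -> (forall i, f x (tnth w i) <= 0) -> scenario_value c X f w <= dotp c x.
Proof.
move=> Xx fx; apply: ge_inf; last by exists x.
by apply: dotp_has_lboundS => y [].
Qed.

(** The complement is open: outside [X] because a compact set is closed, and at a point of [X]
    because positivity of [f] persists on a product neighbourhood, sliced at [delta]. *)
Lemma closed_constraint (Delta : set 'rV[R]_m) delta :
  lower_semicontinuous
    (fun z : subspace (X `*` Delta) => (f z.1 z.2)%:E) ->
  Delta delta -> closed [set x | X x /\ f x delta <= 0].
Proof.
move=> f_lsc Ddelta; rewrite -openC openE => x /= xX.
have [Xx|nXx] := pselect (X x); last first.
  have oX : open (~` X).
    by rewrite openC; apply: compact_closed => //; exact: norm_hausdorff.
  by apply: filterS (open_nbhs_nbhs (conj oX nXx)) => y nXy [].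
have fx : (0%:E < (f x delta)%:E)%E.
  by rewrite lte_fin ltNge; apply/negP => ?; apply: xX.
have [V nV fV] := f_lsc (x, delta) 0 fx.
have XDx : (X `*` Delta) (x, delta) by [].
have [W [[B1 B2] /= [nB1 nB2] BW] VW] := 
  (@nbhs_subspace_ex ('rV[R]_d * 'rV[R]_m)%type _ V _ XDx).1 nV.
apply: filterS nB1 => y B1y [Xy]; apply/negP; rewrite -ltNge -lte_fin.
apply: (fV (y, delta)).
have : (W `&` (X `*` Delta)) (y, delta).
  by split => //; apply: BW; split => //; exact: nbhs_singleton nB2.
by rewrite -VW => -[].
Qed.

Lemma scenario_value_helly (Delta : set 'rV[R]_m) (t : R) :
  Delta !=set0 ->
  convex_set (X : set (convex_lmodType 'rV[R]_d)) ->
  (forall delta, Delta delta ->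
    convex_function (X : set (convex_lmodType 'rV[R]_d)) (f^~ delta)) ->
  (forall delta, Delta delta -> closed [set x | X x /\ f x delta <= 0]) ->
  (exists x, X x /\ forall delta, Delta delta -> f x delta <= 0) ->
  t < robust_value c X f Delta ->
  exists w : d.-tuple 'rV[R]_m,
    (forall i, Delta (tnth w i)) /\ t <= scenario_value c X f w.
Proof.
move=> [delta0 Ddelta0] /convex_setP cX cf clf [z [Xz fz]] tJ.
(* [None] indexes the sublevel set of the objective, [Some u] the constraint of [u]. *)
pose F (o : option Delta) : set 'rV[R]_d :=
  if o is Some u then [set x | X x /\ f x (sval u) <= 0]
  else [set x | X x /\ dotp c x <= t].
have cF o : convex_set (F o : set (convex_lmodType 'rV[R]_d)).
  apply/convex_setP; case: o => [u|] x y a a01 [Xx fx] [Xy fy].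
    split; first exact: cX.
    have /convex_functionP/(_ x y a a01 Xx Xy) := cf _ (set_valP u).
    move=> /le_trans; apply; move: a01 fx fy => /andP[a0 a1] /= fx fy; nra.
  split; first exact: cX.
  by rewrite dotpD !dotpZ; move: a01 fx fy => /andP[a0 a1] /= fx fy; nra.
have clF o : closed (F o).
  case: o => [u|]; first exact: clf (set_valP u).
  apply: closedI; first by apply: compact_closed => //; exact: norm_hausdorff.
  apply: (@closed_comp _ _ (dotp c) [set y | y <= t]); last exact: closed_le.
  by move=> x _; exact: dotp_continuous.
(* Otherwise Helly's theorem gives the finite intersection property, and compactness a robustly
   feasible point of value at most [t]. *)
have [u nFu] : exists u : 'I_d.+1 -> _, forall x, ~ forall k, F (u k) x.
  apply: contrapT => /forallNP nFu.
  have [x Fx] : \bigcap_(o in [set: option Delta]) F o !=set0.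
    move: X_compact; rewrite compact_In0 /mkset; apply.
      exists F => o _; first exact: clF.
      apply/seteqP; split => [x Fx|x []//].
      by split => //; case: o Fx => [?|] [].
    move=> D' _.
    have [x Fx] : exists x, forall k : 'I_(size (finmap.enum_fset D')),
        F (tnth (in_tuple (finmap.enum_fset D')) k) x.
      apply: (helly cF) => v.
      have /existsNP[x] := nFu v.
      by move=> /contrapT; exists x.
    exists x => o /= oD'.
    have /tnthP[k ->] : o \in in_tuple (finmap.enum_fset D') by [].
    exact: Fx.
  have [Xx cx] := Fx None Logic.I.
  have : robust_value c X f Delta <= dotp c x.
    apply: ge_inf; first by apply: dotp_has_lboundS => y [].
    exists x => //; split => // delta Ddelta.
    exact: (Fx (Some (exist _ delta (mem_set Ddelta))) Logic.I).2.
  by rewrite leNgt (le_lt_trans cx tJ).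
(* The feasible point [z] satisfies all constraints, so the sublevel set must occur; removing one
   occurrence leaves [d] indices. *)
have [i ui] : exists i, u i = None.
  apply: contrapT => /forallNP uS; apply: (nFu z) => k.
  by case: (u k) (uS k) => [v _|//]; split => //; exact: fz (set_valP v).
(* Further occurrences of the sublevel set are replaced by the constraint of [delta0], which can
   only raise the value. *)
pose w j := if u (lift i j) is Some v then sval v else delta0.
exists (mktuple w); split.
  by move=> j; rewrite tnth_mktuple /w; case: (u _) => [v|//]; exact: set_valP v.
(* The point [z] rules out the default value 0 of [inf] on the empty set. *)
apply: lb_le_inf.
  exists (dotp c z), z => //; split => // j; apply: fz.
  by rewrite tnth_mktuple /w; case: (u _) => [v|//]; exact: set_valP v.
move=> _ [x [Xx fx] <-]; rewrite leNgt; apply/negP => xt.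
apply: (nFu x) => k; have [j ->|->] := unliftP i k; last first.
  by rewrite ui; split => //; exact: ltW.
have := fx j; rewrite tnth_mktuple /w.
by case: (u _) => [v|] fv; split => //; exact: ltW.
Qed.

(** * Sensitivity of the scenario value under Slater's condition *)

Section slater.
Context (Delta : set 'rV[R]_m) (x0 : 'rV[R]_d) (L : R).
Context (X_convex : convex_set (X : set (convex_lmodType 'rV[R]_d))).
Context (f_convex : forall delta, Delta delta ->
  convex_function (X : set (convex_lmodType 'rV[R]_d)) (f^~ delta)).
Context (f_feasible :
  exists x, X x /\ forall delta, Delta delta -> f x delta <= 0).
Context (X_x0 : X x0).
Context (slater : sup (f x0 @` Delta) < 0).
Context (L_ge0 : 0 <= L).
Context (f_lipschitz : forall x delta1 delta2, X x ->
  Delta delta1 -> Delta delta2 ->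
  `|f x delta1 - f x delta2| <= L * enorm (delta1 - delta2)).

Lemma slater_constant_ge0 : 0 <= slater_constant c X f Delta x0.
Proof.
rewrite /slater_constant -mulrNN mulr_ge0//; last by rewrite oppr_ge0 invr_le0 ltW.
rewrite opprB subr_ge0; apply: ge_inf; first exact: dotp_has_lboundS.
by exists x0.
Qed.

(* A solution violating the constraints by at most [eta] becomes feasible when
   moved towards [x0] by the fraction [eta / (eta - sup (f x0 @` Delta))]. *)
Lemma scenario_value_perturb k n (w : k.-tuple 'rV[R]_m)
    (w' : n.-tuple 'rV[R]_m) (r : R) : 0 <= r ->
  (forall i, Delta (tnth w i)) -> (forall i, Delta (tnth w' i)) ->
  (forall i, exists j, enorm (tnth w i - tnth w' j) <= r) ->
  scenario_value c X f w <=
    scenario_value c X f w' + slater_constant c X f Delta x0 * L * r.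
Proof.
move=> r_ge0 Dw Dw' ww'; rewrite -lerBlDr.
apply: lb_le_inf.
  have [z [Xz fz]] := f_feasible.
  by exists (dotp c z), z => //; split => // j; exact: fz.
move=> _ [x [Xx fx] <-]; rewrite lerBlDr.
pose s := sup (f x0 @` Delta).
have s_lt0 : s < 0 := slater.
(* [sup] is 0 on sets without a supremum, so [s < 0] forces [f x0] to be bounded above on
   [Delta]. *)
have fs delta : Delta delta -> f x0 delta <= s.
  move=> Ddelta; apply: sup_upper_bound; last by exists delta.
  by apply: contrapT => /sup_out s0; move: s_lt0; rewrite /s s0 ltxx.
pose eta := L * r.
have eta_ge0 : 0 <= eta by exact: mulr_ge0.
have es_gt0 : 0 < eta - s by rewrite subr_gt0 (lt_le_trans s_lt0).
pose a := eta / (eta - s).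
have a_ge0 : 0 <= a by rewrite divr_ge0// ltW.
have a_le1 : a <= 1 by rewrite ler_pdivrMr// mul1r lerDl oppr_ge0 ltW.
have as0 : a * s + (1 - a) * eta = 0 by rewrite /a; field; rewrite gt_eqF.
have a01 : 0 <= a <= 1 by rewrite a_ge0.
apply: (@le_trans _ _ (dotp c (a *: x0 + (1 - a) *: x))).
  apply: scenario_value_le.
    by have /convex_setP := X_convex; exact.
  move=> i; have /convex_functionP := f_convex (Dw i).
  move=> /(_ _ _ _ a01 X_x0 Xx)/le_trans; apply.
  have [j wj] := ww' i.
  have fxi : f x (tnth w i) <= eta.
    have := f_lipschitz Xx (Dw i) (Dw' j).
    move=> /(le_trans (ler_norm _)); rewrite lerBlDr => /le_trans; apply.
    have := fx j; have : L * enorm (tnth w i - tnth w' j) <= eta.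
      exact: ler_wpM2l.
    lra.
  rewrite -as0 lerD// ler_wpM2l ?fs// subr_ge0//.
rewrite dotpD !dotpZ /slater_constant -/s -mulrA -/eta.
set M := inf _.
have MX y : X y -> M <= dotp c y.
  by move=> Xy; apply: ge_inf; [exact: dotp_has_lboundS|exists y].
have Mx := MX _ Xx; have Mx0 := MX _ X_x0.
(* Dropping [eta] from the denominator makes the loss linear in [r], with the Slater constant as
   slope. *)
have a_le : a <= eta / - s.
  rewrite /a ler_wpM2l// lef_pV2 ?posrE ?oppr_gt0//.
  by rewrite lerDr.
have -> : (M - dotp c x0) / s * eta = (eta / - s) * (dotp c x0 - M).
  by field; rewrite lt_eqF.
have : a * (dotp c x0 - M) <= (eta / - s) * (dotp c x0 - M).
  by rewrite ler_wpM2r// subr_ge0.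
have : a * (dotp c x0 - dotp c x) <= a * (dotp c x0 - M).
  by rewrite ler_wpM2l// lerD2l lerN2.
lra.
Qed.

End slater.
End constraints.

(** * The Euclidean norm and the topology of row vectors *)

Section enorm.
Context (R : realType) (m : nat).

Lemma enormN (v : 'rV[R]_m) : enorm (- v) = enorm v.
Proof.
by rewrite /enorm; congr (Num.sqrt _); apply: eq_bigr => i _; rewrite mxE sqrrN.
Qed.

Lemma enorm_continuous : continuous (@enorm R m).
Proof.
move=> v; apply: continuous_comp; last exact: sqrt_continuous.
move: v; apply: continuous_big => [|i _ v]; first exact: add_continuous.
apply: (@continuous_comp _ _ _ (fun x : 'rV[R]_m => x ord0 i) (fun y => y ^+ 2)).
  exact: coord_continuous.
exact: exprn_continuous.
Qed.

Lemma open_eball (u : 'rV[R]_m) r : open (eball u r).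
Proof.
rewrite (_ : eball u r = (fun v => enorm (v - u)) @^-1` [set x | x < r])//.
apply: open_comp => [v _|]; last exact: open_lt.
apply: (@continuous_comp 'rV[R]_m 'rV[R]_m R (fun v => v - u) (@enorm R m)).
  by apply: continuousB; [exact: cvg_id|exact: cst_continuous].
exact: enorm_continuous.
Qed.

(** Openness of the Euclidean ball at 0 provides [e], and translation makes it independent of the
    center. *)
Lemma ball_sub_eball (r : R) : 0 < r ->
  exists2 e : R, 0 < e & forall u : 'rV[R]_m, ball u e `<=` eball u r.
Proof.
move=> r0; have : nbhs (0 : 'rV[R]_m) (eball 0 r).
  apply: open_nbhs_nbhs; split; first exact: open_eball.
  rewrite /eball /= subr0 /enorm big1 ?sqrtr0// => i _.
  by rewrite mxE expr0n.
move=> /nbhs_ballP[e /= e0 er]; exists e => // u v uv.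
have := er (v - u); rewrite /eball /= subr0; apply.
by move: uv; rewrite -!ball_normE /= sub0r normrN distrC.
Qed.

Lemma rat_dense_rV (u : 'rV[R]_m) (e : R) : 0 < e ->
  exists q : 'rV[rat]_m, ball (map_mx ratr q : 'rV[R]_m) e u.
Proof.
move=> e0.
have /choice[q uq] : forall j, exists q : rat, ratr q \in `]u ord0 j - e, u ord0 j + e[.
  by move=> j; apply: rat_in_itvoo; rewrite ltrBlDr -addrA ltrDl addr_gt0.
exists (\row_j q j); rewrite /ball /=; split=> // i j.
rewrite !mxE !ord1 /ball /= ltr_norml.
by have := uq j; rewrite in_itv /= => /andP[]; lra.
Qed.

End enorm.

(** * Measurable sets in [Delta] and its powers *)

Section borelSpace.
Context (R : realType) (m : nat) (Delta : set 'rV[R]_m)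
  (Delta0 : Delta !=set0).

Lemma toRm_in (t : borelSpace Delta0) : Delta (toRm t).
Proof. exact: set_valP. Qed.

Lemma measurable_toRm_open (U : set 'rV[R]_m) : open U ->
  measurable [set t : borelSpace Delta0 | U (toRm t)].
Proof.
move=> oU; apply: sub_sigma_algebra.
apply: (@open_comp _ _ (@set_val _ Delta) U) => // t _.
exact: initial_continuous.
Qed.

End borelSpace.

Lemma measurable_tuple_box d (T : measurableType d) (n : nat)
    (B : 'I_n -> set T) : (forall i, measurable (B i)) ->
  measurable [set w : n.-tuple T | forall i, B i (tnth w i)].
Proof.
move=> mB.
have -> : [set w : n.-tuple T | forall i, B i (tnth w i)] =
    \bigcap_(i in [set: 'I_n]) ((fun w => tnth w i) @^-1` B i).
  by apply/seteqP; split => [w Bw i _|w Bw i]; [exact: Bw|exact: Bw].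
apply: fin_bigcap_measurable => // i _.
by rewrite -[X in measurable X]setTI; exact: measurable_tnth.
Qed.

(* [U] is a countable union of boxes with rational centers and radii [1/(k+1)]. *)
Lemma measurable_tuple_open (R : realType) (m : nat) (Delta : set 'rV[R]_m)
    (Delta0 : Delta !=set0) (n : nat) (U : set (n.-tuple (borelSpace Delta0))) :
  (forall w, U w -> exists2 r : R, 0 < r & forall w',
    (forall i, enorm (toRm (tnth w' i) - toRm (tnth w i)) < r) -> U w') ->
  measurable U.
Proof.
move=> oU.
pose box (p : {ffun 'I_n -> 'rV[rat]_m} * nat) :=
  [set w : n.-tuple (borelSpace Delta0) | forall i,
    ball (map_mx ratr (p.1 i) : 'rV[R]_m) p.2.+1%:R^-1 (toRm (tnth w i))].
have mbox p : measurable (box p).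
  apply: (@measurable_tuple_box _ (borelSpace Delta0) _ (fun i =>
    [set t | ball (map_mx ratr (p.1 i) : 'rV[R]_m) p.2.+1%:R^-1 (toRm t)])) => i.
  by apply: measurable_toRm_open; exact: ball_open.
have -> : U = \bigcup_(p in [set p | box p `<=` U]) box p.
  apply/seteqP; split => [w Uw|w [p /= + wp]]; last exact.
  have [r r0 wr] := oU _ Uw.
  have [e e0 er] := ball_sub_eball m r0.
  (* The radius is below [e / 2] because [w] and [w'] are compared through the rational center. *)
  have [k ke] : exists k, k.+1%:R^-1 < e / 2.
    have e2 : 0 < e / 2 by rewrite divr_gt0.
    have [k _ ke] := near_infty_natSinv_lt (PosNum e2).
    by exists k; exact: ke (leqnn k).
  have k0 : 0 < k.+1%:R^-1 :> R by rewrite invr_gt0.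
  have /choice[q wq] : forall i, exists q : 'rV[rat]_m,
      ball (map_mx ratr q : 'rV[R]_m) k.+1%:R^-1 (toRm (tnth w i)).
    by move=> i; exact: rat_dense_rV.
  exists ([ffun i => q i], k) => /= [w' w'q|i]; last by rewrite /= ffunE; exact: wq.
  apply: wr => i; apply: er; have := w'q i; rewrite /= ffunE.
  move=> /(ball_triangle (ball_sym (wq i))); apply: le_ball.
  by rewrite [leRHS]splitr lerD// ltW.
(* Boxes not inside [U] become empty, so that the union runs over a whole countable type. *)
have -> : \bigcup_(p in [set p | box p `<=` U]) box p =
    \bigcup_p (if `[< box p `<=` U >] then box p else set0).
  apply/seteqP; split => [w [p pU wp]|w [p _]].
    by exists p => //; rewrite ifT//; exact/asboolP.
  by case: asboolP => // pU wp; exists p.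
apply: countable_bigcupT_measurable; first exact: countableP.
by move=> p; case: ifP.
Qed.

(** * Probability that a sample hits each of [k] sets *)

Section covering_probability.
Context d (T : measurableType d) (R : realType) (P : probability T R).

Lemma power_probability_avoid (n : nat) (B : set T) (p : R) :
  measurable B -> (p%:E <= P B)%E ->
  (power_probability P n [set w | forall i, ~ B (tnth w i)] <=
    ((1 - p) ^+ n)%:E)%E.
Proof.
move=> mB pB.
rewrite (power_probability_box P (A := fun=> ~` B)); last first.
  by move=> _; exact: measurableC.
have : (P (~` B) <= (1 - p)%:E)%E.
  by rewrite probability_setC// EFinB leeB.
have : (0 <= P (~` B))%E by [].
elim: n => [|n IHn] B0 Bp; first by rewrite big_ord0.
rewrite big_ord_recl exprS EFinM lee_pmul//; last exact: IHn.
by apply: prode_ge0.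
Qed.

Lemma power_probability_cover (k n : nat) (B : 'I_k -> set T) (p : R) :
  (forall j, measurable (B j)) -> (forall j, p%:E <= P (B j))%E ->
  ((1 - k%:R * (1 - p) ^+ n)%:E <= power_probability P n
    [set w | forall j, exists i, B j (tnth w i)])%E.
Proof.
move=> mB pB.
pose A j := [set w : n.-tuple T | forall i, ~ B j (tnth w i)].
have mA j : measurable (A j).
  by apply: (measurable_tuple_box (B := fun=> ~` B j)) => _; exact: measurableC.
(* [A] is extended by empty sets to a sequence, the form in which Boole's inequality applies. *)
pose A' l := oapp A set0 (insub l).
have mA' l : measurable (A' l) by rewrite /A'; case: insub => //=.
have -> : [set w | forall j, exists i, B j (tnth w i)] =
    ~` \big[setU/set0]_(l < k) A' l.
  rewrite -bigcup_mkord; apply/seteqP; split => [w Bw [l _]|w Aw j].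
    by rewrite /A'; case: insubP => //= j _ _; have [i] := Bw j; move=> + /(_ i).
  apply: contrapT => /forallNP Bw; apply: Aw; exists j => //=.
  by rewrite /A' valK.
rewrite probability_setC ?EFinB; last exact: bigsetU_measurable.
rewrite leeB//; apply: le_trans (Boole_inequality _ _) _ => //.
apply: (@le_trans _ _ (\sum_(j < k) ((1 - p) ^+ n)%:E)%E).
  apply: lee_sum => j _; rewrite /A' valK; exact: power_probability_avoid.
by rewrite sumEFin sumr_const card_ord mulr_natl.
Qed.

End covering_probability.

(** [Phi_a] equals [d] at 0 and, as [N] is positive, 0 at 1; the intermediate value theorem puts
    [beta] in its range, where [pinv] is a right inverse. *)
Lemma Phi_a_invK (R : realType) (d N : nat) (beta : R) :
  (0 < d)%N -> (0 < N)%N -> 0 < beta < 1 ->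
  Phi_a d N (Phi_a_inv d N beta) = beta.
Proof.
move=> d0 N0 /andP[b0 b1].
have : (@Phi_a R d N @` `[0, 1]) beta.
  have [||eps eps01 eb] := @IVT R (Phi_a d N) 0 1 beta ler01.
  - apply: continuous_subspaceT => x.
    apply: (@continuous_comp _ _ _ (fun x : R => (1 - x) ^+ N) (fun y => d%:R * y)).
      apply: (@continuous_comp _ _ _ (fun x : R => 1 - x) (fun y => y ^+ N));
        last exact: exprn_continuous.
      by apply: continuousB => //; exact: cst_continuous.
    exact: mulrl_continuous.
  - rewrite /Phi_a subr0 subrr expr1n mulr1 expr0n gtn_eqF// mulr0.
    rewrite min_r// max_l// (ltW b0)/= (le_trans (ltW b1))//.
    by rewrite ler1n.
  - by exists eps.
by move=> /mem_set bI; exact: (pinvK (fun=> 0) bI).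
Qed.

(** * The probabilistic bound on the optimality gap *)

Theorem corollary2 (R : realType) (d m : nat) (d_ge1 : (1 <= d)%N)
  (c : 'rV[R]_d) (X : set 'rV[R]_d)
  (Delta : set 'rV[R]_m) (Delta0 : Delta !=set0)
  (f : 'rV[R]_d -> 'rV[R]_m -> R)
  (P : probability (borelSpace Delta0) R)
  (P_support : msupport P = [set: subspaceOf Delta0])
  (X_compact : compact X)
  (X_convex : convex_set (X : set (convex_lmodType 'rV[R]_d)))
  (f_lsc : lower_semicontinuous
    (fun z : subspace (X `*` Delta) => (f z.1 z.2)%:E))
  (f_convex : forall delta, Delta delta ->
    convex_function (X : set (convex_lmodType 'rV[R]_d)) (f^~ delta))
  (feasible : exists x, X x /\ forall delta, Delta delta -> f x delta <= 0)
  (phi : R -> R)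
  (phi_01 : forall r : R, 0 <= r -> 0 <= phi r <= 1)
  (phi_incr : forall r s : R, 0 <= r -> r < s -> phi r < phi s)
  (phi_ball : forall (delta : 'rV[R]_m) (r : R), closure Delta delta -> 0 <= r ->
    ((phi r)%:E <= P [set t : borelSpace Delta0 | eball delta r (toRm t)])%E)
  (L_g : R) (L_g_ge0 : 0 <= L_g)
  (g_lipschitz : forall omega omega' : d.-tuple 'rV[R]_m,
    (forall i, closure Delta (tnth omega i)) ->
    (forall i, closure Delta (tnth omega' i)) ->
    `|scenario_value c X f omega - scenario_value c X f omega'| <=
      L_g * \big[Num.max/0]_(i < d) enorm (tnth omega i - tnth omega' i))
  (x0 : 'rV[R]_d) (X_x0 : X x0)
  (slater : sup (f x0 @` Delta) < 0)
  (L_delta : R) (L_delta_ge0 : 0 <= L_delta)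
  (f_lipschitz : forall (x : 'rV[R]_d) (delta1 delta2 : 'rV[R]_m), X x ->
    closure Delta delta1 -> closure Delta delta2 ->
    `|f x delta1 - f x delta2| <= L_delta * enorm (delta1 - delta2))
  (N : nat) (d_le_N : (d <= N)%N)
  (beta : R) (beta_01 : 0 < beta < 1)
  (phi_inv_def : (phi @` `[0, +oo[) (Phi_a_inv d N beta)) :
  ((1 - beta)%:E <= power_probability P N
    [set omega : N.-tuple (borelSpace Delta0) |
      (robust_value c X f Delta
         - scenario_value c X f (map_tuple (@toRm _ _ _ Delta0) omega)
       <= slater_constant c X f Delta x0 * L_delta
          * inv_nneg phi (Phi_a_inv d N beta))%R])%E.
Proof.
set p := Phi_a_inv d N beta; set r := inv_nneg phi p; set K := _ * L_delta.
have r_ge0 : 0 <= r.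
  have : `[0, +oo[%classic r by exact: funS phi_inv_def.
  by rewrite /= in_itv/= andbT.
have phi_r : phi r = p by exact: (pinvK (fun=> 0) (mem_set phi_inv_def)).
have beta_p : d%:R * (1 - p) ^+ N = beta.
  by apply: Phi_a_invK => //; exact: leq_trans d_le_N.
have f_lip x delta1 delta2 : X x -> Delta delta1 -> Delta delta2 ->
    `|f x delta1 - f x delta2| <= L_delta * enorm (delta1 - delta2).
  by move=> Xx D1 D2; apply: f_lipschitz => //; exact: subset_closure.
have perturb k n (w : k.-tuple 'rV[R]_m) (w' : n.-tuple 'rV[R]_m) s : 0 <= s ->
    (forall i, Delta (tnth w i)) -> (forall i, Delta (tnth w' i)) ->
    (forall i, exists j, enorm (tnth w i - tnth w' j) <= s) ->
    scenario_value c X f w <= scenario_value c X f w' + K * s.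
  exact: scenario_value_perturb.
have K_ge0 : 0 <= K by rewrite mulr_ge0//; exact: slater_constant_ge0.
set J := robust_value c X f Delta.
pose g (w : N.-tuple (borelSpace Delta0)) :=
  scenario_value c X f (map_tuple (@toRm _ _ _ Delta0) w).
pose A (eps : R) := [set w | J - g w <= K * r + eps].
(* By [perturb] the scenario value varies by at most [K] times the sample displacement, so the
   complement of [A eps] is open. *)
have mA eps : measurable (A eps).
  rewrite -[A eps]setCK; apply: measurableC; apply: measurable_tuple_open => w.
  rewrite /A /= => /negP; rewrite -ltNge => gw.
  pose gap := J - g w - (K * r + eps).
  have gap0 : 0 < gap by rewrite subr_gt0.
  have K1 : 0 < K + 1 by rewrite ltr_wpDl.
  (* Dividing by [K + 1] keeps the radius meaningful when [K = 0] and the final inequality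
     strict. *)
  exists (gap / (K + 1)); first by rewrite divr_gt0.
  move=> w' ww'; apply/negP; rewrite -ltNge.
  have : g w' <= g w + K * (gap / (K + 1)).
    apply: perturb => [|i|i|i]; rewrite ?tnth_map; try exact: toRm_in.
      by rewrite divr_ge0// ltW.
    by exists i; rewrite tnth_map ltW.
  have : K * (gap / (K + 1)) < gap.
    by rewrite mulrA ltr_pdivrMr// mulrC ltr_pM2l// ltrDl.
  rewrite /gap; lra.
have PA n : ((1 - beta)%:E <= power_probability P N (A (n.+1%:R^-1)%R))%E.
  have clf delta : Delta delta -> closed [set x | X x /\ f x delta <= 0].
    exact: closed_constraint.
  have Jn : J - n.+1%:R^-1 < J by rewrite ltrBlDr ltrDl invr_gt0.
  (* The slack in [A] is spent here: [t] is the robust value minus that slack. *)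
  have [w [Dw Jw]] :=
    scenario_value_helly X_compact Delta0 X_convex f_convex clf feasible Jn.
  pose B j := [set t : borelSpace Delta0 | eball (tnth w j) r (toRm t)].
  have mB j : measurable (B j) by apply: measurable_toRm_open; exact: open_eball.
  have pB j : (p%:E <= P (B j))%E.
    by rewrite -phi_r; apply: phi_ball => //; exact: subset_closure.
  have := power_probability_cover N mB pB; rewrite beta_p => /le_trans; apply.
  apply: le_measure; rewrite ?inE//.
    rewrite (_ : [set _ | _] = \bigcap_(j in [set: 'I_d]) \bigcup_(i in [set: 'I_N])
      ((fun v => tnth v i) @^-1` B j)).
      apply: fin_bigcap_measurable => // j _; apply: fin_bigcup_measurable => // i _.
      by rewrite -[X in measurable X]setTI; exact: measurable_tnth.
    apply/seteqP; split => [v Bv j _|v Bv j].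
      by have [i] := Bv j; exists i.
    by have [i _] := Bv j Logic.I; exists i.
  move=> v Bv; rewrite /A /=.
  have : scenario_value c X f w <= g v + K * r.
    apply: perturb => // i; first by rewrite tnth_map; exact: toRm_in.
    have [j] := Bv i; exists j; rewrite tnth_map -enormN opprB.
    exact: ltW.
  move: (n.+1%:R^-1) Jw => e Jw; lra.
(* The slack-free event is a decreasing limit of the [A] events, which also makes it measurable. *)
have -> : [set w | J - g w <= K * r] = \bigcap_n A n.+1%:R^-1.
  apply/seteqP; split => [w /= Jg n _|w Aw /=].
    by rewrite /A /= (le_trans Jg)// lerDl invr_ge0.
  apply/ler_addgt0Pr => e e0.
  have [n _ ne] := near_infty_natSinv_lt (PosNum e0).
  by rewrite (le_trans (Aw n Logic.I))// lerD2l ltW//; exact: ne (leqnn n).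
have PAcvg : (power_probability P N \o (fun n => A n.+1%:R^-1)) n @[n --> \oo] -->
    power_probability P N (\bigcap_n A n.+1%:R^-1).
  apply: nonincreasing_cvg_mu => //.
  - by rewrite (le_lt_trans (probability_le1 _ _))// ltry.
  - exact: bigcapT_measurable.
  - move=> n k nk; apply/subsetPset => w; rewrite /A /= => /le_trans; apply.
    by rewrite lerD2l lef_pV2 ?posrE// ler_nat.
rewrite -(cvg_lim _ PAcvg)//; apply: lime_ge; last exact: nearW.
by apply/cvg_ex; eexists; exact: PAcvg.
Qed.
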